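(* Let $X,Y$ be normed spaces, let $g:X\to Y$ be calm at $\bar x$, and let $h:Y\to(-\infty,\infty]$ be finite at $\bar y:=g(\bar x)$. Suppose that the sets $C:=X\times\operatorname{epi}h$ and $D:=\operatorname{gph}g\times\mathbb R$ in $X\times Y\times\mathbb R$ satisfy the metric qualification condition $(Q_2)$ with respect to $\widehat\partial$ at $\bar w:=(\bar x,\bar y,h(\bar y))$, i.e., there exists $a>0$ such that $$\widehat\partial d(\cdot,C\cap D)(\bar w)\subset a\,\widehat\partial d(\cdot,C)(\bar w)+a\,\widehat\partial d(\cdot,D)(\bar w).$$ Then the composition $(h\circ g)(x)=h(g(x))$ satisfies $$\widehat\partial(h\circ g)(\bar x)=\bigcup_{y^*\in\widehat\partial h(\bar y)}\widehat\partial\langle y^*,g\rangle(\bar x),\qquad\widehat\partial^{\infty}(h\circ g)(\bar x)=\bigcup_{y^*\in\widehat\partial^{\infty}h(\bar y)}\widehat\partial\langle y^*,g\rangle(\bar x).$$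
   Context: $X^*$ is the topological dual of $X$; $\mathbb B(\bar x,r)$ is the open ball; product spaces carry the sum norm; $d(z,S)$ is the distance from $z$ to the set $S$. For an extended-real-valued $f$ on $Z$, $\operatorname{epi}f=\{(z,\alpha)\in Z\times\mathbb R\mid\alpha\ge f(z)\}$; $\operatorname{gph}g=\{(x,y)\in X\times Y\mid y=g(x)\}$. For $y^*\in Y^*$, $\langle y^*,g\rangle$ denotes the function $x\mapsto\langle y^*,g(x)\rangle$. Calmness: $g:X\to Y$ is calm at $\bar x$ if there are $r>0$, $\ell\ge0$ with $\|g(x)-g(\bar x)\|\le\ell\|x-\bar x\|$ for all $x\in\mathbb B(\bar x,r)$. Regular subdifferential: for $f$ finite at $\bar z$, $\widehat\partial f(\bar z)$ is the set of $z^*\in Z^*$ such that for every $\varepsilon>0$ there is $\gamma>0$ with $f(z)-f(\bar z)-\langle z^*,z-\bar z\rangle\ge-\varepsilon\|z-\bar z\|$ for all $z\in\mathbb B(\bar z,\gamma)$. Regular normal cone: for $S\subset Z$ and $\bar z\in S$, $\widehat N(\bar z;S)=\{z^*\in Z^*\mid \limsup_{z\to\bar z,\,z\in S}\langle z^*,\frac{z-\bar z}{\|z-\bar z\|}\rangle\le0\}$. Singular regular subdifferential: $\widehat\partial^{\infty}f(\bar z)=\{z^*\in Z^*\mid(z^*,0)\in\widehat N((\bar z,f(\bar z));\operatorname{epi}f)\}$. *)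

(* Defs.v *)
From HB Require Import structures.
From mathcomp Require Import all_boot all_order all_algebra.
From mathcomp Require Import all_classical all_reals all_analysis.
Import Order.TTheory GRing.Theory Num.Theory.
Import numFieldNormedType.Exports.

Set Implicit Arguments.
Unset Strict Implicit.
Unset Printing Implicit Defensive.

Local Open Scope classical_set_scope.
Local Open Scope ring_scope.

(* The library norms [X * Y] by the maximum norm; the alias [sumprod X Y]
   carries the sum norm instead. *)
Definition sumprod {R : realType} (X Y : normedModType R) : Type :=
  (X * Y)%type.

Section sumprod_norm.
Context {R : realType} (X Y : normedModType R).

HB.instance Definition _ := GRing.Lmodule.copy (sumprod X Y) (X * Y)%type.

Definition sum_norm (w : sumprod X Y) : R := `|w.1| + `|w.2|.

Fact ler_sum_normD (v w : sumprod X Y) :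
  sum_norm (v + w) <= sum_norm v + sum_norm w.
Proof. by rewrite /sum_norm addrACA lerD// ler_normD. Qed.

Fact sum_normZ (a : R) (w : sumprod X Y) :
  sum_norm (a *: w) = `|a| * sum_norm w.
Proof. by rewrite /sum_norm !normrZ mulrDr. Qed.

Fact sum_norm_eq0 (w : sumprod X Y) : sum_norm w = 0 -> w = 0.
Proof.
case: w => x y; rewrite /sum_norm /= => /eqP.
by rewrite paddr_eq0// !normr_eq0 => /andP[/eqP-> /eqP->].
Qed.

HB.instance Definition _ :=
  @Lmodule_isNormed.Build R (sumprod X Y) sum_norm
    ler_sum_normD sum_normZ sum_norm_eq0.

Lemma sumprod_normE (w : sumprod X Y) : `|w| = `|w.1| + `|w.2|.
Proof. by []. Qed.

End sumprod_norm.

Definition dual {R : realType} (Z : normedModType R) : set (Z -> R) :=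
  [set zs : Z -> R | scalar zs /\ continuous zs].

Definition calm_at {R : realType} {X Y : normedModType R} (g : X -> Y)
    (xb : X) : Prop :=
  exists r l : R, [/\ 0 < r, 0 <= l &
    forall x, ball xb r x -> `|g x - g xb| <= l * `|x - xb|].

Definition epi {R : realType} {Z : normedModType R} (f : Z -> \bar R) :
    set (sumprod Z R^o) :=
  [set w | (f w.1 <= w.2%:E)%E].

Definition gph {R : realType} {X Y : normedModType R} (g : X -> Y) :
    set (sumprod X Y) :=
  [set w | w.2 = g w.1].

(* Meant for [f zb] finite. *)
Definition regular_subdiff {R : realType} {Z : normedModType R}
    (f : Z -> \bar R) (zb : Z) : set (Z -> R) :=
  [set zs : Z -> R | dual zs /\
    forall e : R, 0 < e -> exists2 c : R, 0 < c &
      forall z, ball zb c z ->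
        ((- (e * `|z - zb|))%:E <= f z - f zb - (zs (z - zb))%:E)%E].

(* Meant for [S zb].  The point [zb] itself, where the quotient is undefined,
   is excluded from the upper limit; if [zb] is isolated in [S], the upper
   limit is [-oo]. *)
Definition regular_normal_cone {R : realType} {Z : normedModType R}
    (zb : Z) (S : set Z) : set (Z -> R) :=
  [set zs : Z -> R | dual zs /\
    (limf_esup (fun z => (zs (`|z - zb|^-1 *: (z - zb)))%:E)
       (within S zb^') <= 0)%E].

Definition dual_pair {R : realType} {Z : normedModType R} (zs : Z -> R)
    (t : R) : sumprod Z R^o -> R :=
  fun w => zs w.1 + t * w.2.

(* Meant for [f zb] finite. *)
Definition singular_regular_subdiff {R : realType} {Z : normedModType R}
    (f : Z -> \bar R) (zb : Z) : set (Z -> R) :=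
  [set zs : Z -> R | dual zs /\
    regular_normal_cone ((zb, fine (f zb)) : sumprod Z R^o) (epi f)
      (dual_pair zs 0)].

(* The distance from a point to a set is the library's [edist_inf], which
   takes values in [\bar R] ([+oo] for the empty set). *)
Definition metric_qualification2 {R : realType} {Z : normedModType R}
    (C D : set Z) (wb : Z) : Prop :=
  exists2 a : R, 0 < a &
    regular_subdiff (edist_inf (C `&` D)) wb `<=`
    [set (fun w => a * u w + a * v w) |
      u in regular_subdiff (edist_inf C) wb &
      v in regular_subdiff (edist_inf D) wb].

(* Both sets live in X x (Y x R). *)
Definition X_times_epi {R : realType} {X Y : normedModType R}
    (h : Y -> \bar R) : set (sumprod X (sumprod Y R^o)) :=
  [set w | epi h w.2].

Definition gph_times_R {R : realType} {X Y : normedModType R}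
    (g : X -> Y) : set (sumprod X (sumprod Y R^o)) :=
  [set w | gph g (w.1, w.2.1)].

(* Main.v *)
(** Both equalities are instances of one chain rule for the sets
    [epi_normal f zb t] of functionals [zs] such that [(zs, t)] is a regular
    normal to [epi f] at [(zb, f zb)]: the regular subdifferential is the case
    [t = -1] and the singular one the case [t = 0].

    If [(xs, t)] is normal to [epi (h \o g)], then [(xs, 0, t)] is normal to
    [C `&` D], so after scaling it into the dual unit ball it is a regular
    subgradient of the distance to [C `&` D].  Condition (Q2) splits it into
    multiples of a normal [u] to [C = X * epi h] and a normal [v] to
    [D = gph g * R].  As [C] is invariant along [X] and [D] along [R], [u] has
    no [X]-component and [v] no [R]-component, so the splitting reads
    [u ~ (0, ys, t)] and [v ~ (xs, - ys, 0)].  Calmness turns the normality of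
    [v] to [gph g] into [xs] being a subgradient of [ys \o g]. *)
Require Import Defs.
From mathcomp Require Import all_boot all_order all_algebra.
From mathcomp Require Import all_classical all_reals all_analysis.
From mathcomp Require Import ring lra.
Import Order.TTheory GRing.Theory Num.Theory.
Import numFieldNormedType.Exports.

Set Implicit Arguments.
Unset Strict Implicit.
Unset Printing Implicit Defensive.

Local Open Scope classical_set_scope.
Local Open Scope ring_scope.

(** * Linear functionals and their boundedness *)

Lemma scalar_fun0 (R : realType) (Z : lmodType R) (zs : Z -> R) :
  scalar zs -> zs 0 = 0.
Proof.
move=> zsL; have := zsL (-1) 0 0.
by rewrite scaler0 addr0 mulN1r addNr.
Qed.

Lemma scalar_funZ (R : realType) (Z : lmodType R) (zs : Z -> R) :
  scalar zs -> forall a z, zs (a *: z) = a * zs z.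
Proof.
by move=> zsL a z; rewrite -[a *: z]addr0 zsL (scalar_fun0 zsL) addr0.
Qed.

Lemma scalar_funD (R : realType) (Z : lmodType R) (zs : Z -> R) :
  scalar zs -> forall y z, zs (y + z) = zs y + zs z.
Proof. by move=> zsL y z; rewrite -[y]scale1r zsL mul1r scale1r. Qed.

Lemma scalar_funB (R : realType) (Z : lmodType R) (zs : Z -> R) :
  scalar zs -> forall y z, zs (y - z) = zs y - zs z.
Proof.
move=> zsL y z.
by rewrite (scalar_funD zsL) -scaleN1r (scalar_funZ zsL) mulN1r.
Qed.

Lemma normed_ballE (R : realType) (Z : normedModType R) (z w : Z) (c : R) :
  ball z c w = (`|w - z| < c) :> Prop.
Proof. by rewrite -ball_normE /ball_/= distrC. Qed.

(** Continuity at [0] with tolerance [1] bounds [zs] on vectors of norm [d / 2], and homogeneity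
    spreads this bound to the whole space. Conversely, a bounded linear functional is Lipschitz. *)
Lemma dualP (R : realType) (Z : normedModType R) (zs : Z -> R) :
  dual zs <->
  scalar zs /\ exists2 M : R, 0 < M & forall z, `|zs z| <= M * `|z|.
Proof.
split=> [[zsL zsC]|[zsL [M M0 zsM]]].
  split=> //.
  have /cvgrPdist_lt /(_ 1 ltr01) := zsC 0.
  rewrite (scalar_fun0 zsL) => /nbhs_ballP[d /= d0 dP].
  exists (2 / d); first by rewrite divr_gt0.
  move=> z; have [->|z0] := eqVneq z 0.
    by rewrite (scalar_fun0 zsL) !normr0 mulr0.
  have nz0 : 0 < `|z| by rewrite normr_gt0.
  have := dP ((d / 2 / `|z|) *: z); rewrite normed_ballE subr0 normrZ /=.
  have k0 : 0 < d / 2 / `|z| by rewrite !divr_gt0.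
  rewrite (gtr0_norm k0) divfK ?gt_eqF// => /(_ _) dz.
  have := dz ltac:(lra); rewrite sub0r normrN (scalar_funZ zsL) normrM.
  rewrite (gtr0_norm k0) -ltr_pdivlMl// mulr1 => /ltW/le_trans; apply.
  by rewrite !invf_div mulrA [`|z| * 2]mulrC mulrAC.
split=> // z; apply/cvgrPdist_lt => e e0; apply/nbhs_ballP.
exists (e / M) => /=; first by rewrite divr_gt0.
move=> w; rewrite normed_ballE distrC -(scalar_funB zsL).
rewrite ltr_pdivlMr// mulrC; apply: le_lt_trans.
by rewrite (le_trans (zsM _))// distrC.
Qed.

(** * Regular normals in epsilon-delta form *)

(** The upper limit in the normal cone, with the quotient cleared. The base point can then stay in,
    since both sides vanish there for linear [zs]. *)
Definition normal_ineq (R : realType) (Z : normedModType R) (zs : Z -> R)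
    (zb : Z) (S : set Z) : Prop :=
  forall e : R, 0 < e -> exists2 c : R, 0 < c &
    forall z, S z -> `|z - zb| < c -> zs (z - zb) <= e * `|z - zb|.

Lemma regular_normal_coneP (R : realType) (Z : normedModType R) (zb : Z)
    (S : set Z) (zs : Z -> R) :
  regular_normal_cone zb S zs <-> dual zs /\ normal_ineq zs zb S.
Proof.
split=> -[zsD zsN]; have [zsL _] := zsD; split=> //.
  move=> e e0.
  have /ereal_inf_lt : (limf_esup
      (fun z => (zs (`|z - zb|^-1 *: (z - zb)))%:E) (within S zb^') < e%:E)%E.
    by rewrite (le_lt_trans zsN)// lte_fin.
  case=> _ [V /nbhs_ballP[c /= c0 cV] <-] Ve; exists c => // z Sz zc.
  have [->|zzb] := eqVneq z zb.
    by rewrite subrr normr0 mulr0 (scalar_fun0 zsL).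
  have Vz : V z by apply: cV => //=; rewrite normed_ballE.
  have := le_lt_trans (ereal_sup_ubound (imageP _ Vz)) Ve.
  rewrite lte_fin (scalar_funZ zsL) ltr_pdivrMl ?normr_gt0 ?subr_eq0//.
  by rewrite mulrC => /ltW.
apply/lee_addgt0Pr => e e0; rewrite add0e.
have [c c0 cP] := zsN e e0.
(* The upper limit is an infimum of suprema, so the supremum over one member of the filter, the
   punctured [c]-ball within [S], bounds it. *)
apply: (@le_trans _ _ (ereal_sup [set (zs (`|z - zb|^-1 *: (z - zb)))%:E |
    z in [set z | [/\ S z, z != zb & `|z - zb| < c]]])).
  apply: ereal_inf_lbound; eexists; last reflexivity.
  apply/nbhs_ballP; exists c => //= z; rewrite normed_ballE => zc zzb Sz.
  by split.
apply: ge_ereal_sup => _ [z [Sz zzb zc] <-].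
rewrite lee_fin (scalar_funZ zsL) ler_pdivrMl ?normr_gt0 ?subr_eq0//.
by rewrite mulrC cP.
Qed.

(** * Normals and the distance function *)

Lemma edist_norm (R : realType) (Z : normedModType R) (x y : Z) :
  edist (x, y) = `|x - y|%:E.
Proof.
apply/eqP; rewrite eq_le; apply/andP; split.
  apply/lee_addgt0Pr => e e0; rewrite -EFinD; apply: edist_fin => /=.
    by rewrite ltr_wpDl.
  by rewrite normed_ballE distrC ltrDl.
apply: le_ereal_inf_tmp => _ [r [_ /=]] + <-.
by rewrite normed_ballE distrC lee_fin => /ltW.
Qed.

Lemma edist_inf0 (R : realType) (Z : normedModType R) (S : set Z) (z : Z) :
  S z -> edist_inf S z = 0%E.
Proof.
move=> Sz; apply/eqP; rewrite eq_le edist_inf_ge0 andbT.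
by rewrite -(edist_refl z); apply: ereal_inf_lbound; exists z.
Qed.

(** Compare [z] with each [s] in [S]. If [s] is at least as far from [z] as [zb] is, the bound [zs1]
    suffices. Otherwise [s] is close to [zb], and [zs (z - zb)] splits at [s] into a part below
    [|z - s|] and a part controlled by normality. *)
Lemma regular_subdiff_edist_inf (R : realType) (Z : normedModType R)
    (S : set Z) (zb : Z) (zs : Z -> R) :
  S zb -> dual zs -> (forall z, zs z <= `|z|) -> normal_ineq zs zb S ->
  regular_subdiff (edist_inf S) zb zs.
Proof.
move=> Szb zsD zs1 zsN; have [zsL _] := zsD; split=> // e e0.
have [c c0 cP] := zsN (e / 2) ltac:(lra).
(* Half of [c], because a near [s] only satisfies [|s - zb| <= 2 * |z - zb|]; the same factor
   explains [e / 2]. *)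
exists (c / 2); first by rewrite divr_gt0.
move=> z; rewrite normed_ballE => zc.
rewrite (edist_inf0 Szb) sube0 leeBrDr// -EFinD.
apply: le_ereal_inf_tmp => _ [s Ss <-]; rewrite edist_norm lee_fin.
have [far|near] := leP `|z - zb| `|z - s|.
  have := zs1 (z - zb); have := mulr_ge0 (ltW e0) (normr_ge0 (z - zb)); lra.
have szb : `|s - zb| <= 2 * `|z - zb|.
  rewrite -[s - zb](subrKA z) (le_trans (ler_normD _ _))// distrC.
  by rewrite mulr_natl mulr2n lerD2r ltW.
have := cP s Ss ltac:(lra).
have -> : zs (z - zb) = zs (z - s) + zs (s - zb).
  by rewrite -(scalar_funD zsL) subrKA.
have := zs1 (z - s); have := ler_wpM2l (ltW e0) szb; lra.
Qed.

Lemma regular_subdiff_edist_inf_normal (R : realType) (Z : normedModType R)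
    (S : set Z) (zb : Z) (zs : Z -> R) :
  S zb -> regular_subdiff (edist_inf S) zb zs -> normal_ineq zs zb S.
Proof.
move=> Szb [_ zsN] e e0; have [c c0 cP] := zsN e e0; exists c => // z Sz zc.
have := cP z; rewrite normed_ballE => /(_ zc).
by rewrite !edist_inf0// sube0 sub0e -EFinN lee_fin lerN2.
Qed.

(** Along a ray both sides of the normal inequality scale by [s], so one small [s] yields
    [zs d <= e]. Used for [d] and [- d], this makes a normal vanish on directions in which [S] is
    invariant. *)
Lemma normal_ineq_dir_le0 (R : realType) (Z : normedModType R)
    (S : set Z) (zb d : Z) (zs : Z -> R) :
  scalar zs -> normal_ineq zs zb S ->
  (forall s : R, 0 < s -> S (zb + s *: d)) -> zs d <= 0.
Proof.
move=> zsL zsN Sd.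
have dn : 0 < `|d| + 1 by rewrite ltr_wpDl.
apply/ler_addgt0Pr => e e0; rewrite add0r.
have [c c0 cP] := zsN (e / (`|d| + 1)) ltac:(by rewrite divr_gt0).
have s0 : 0 < c / (`|d| + 1) by rewrite divr_gt0.
have := cP _ (Sd _ s0); rewrite addrAC subrr add0r normrZ gtr0_norm//.
have -> : c / (`|d| + 1) * `|d| < c.
  by rewrite mulrAC ltr_pdivrMr// ltr_pM2l// ltrDl.
move=> /(_ isT); rewrite (scalar_funZ zsL) mulrCA ler_pM2l// => /le_trans; apply.
by rewrite mulrAC ler_pdivrMr// ler_pM2l// lerDl.
Qed.

(** * Continuous functionals on products with the sum norm *)

Lemma dualZ (R : realType) (Z : normedModType R) (a : R) (zs : Z -> R) :
  dual zs -> dual (fun z => a * zs z).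
Proof.
move=> /dualP[zsL [M M0 zsM]]; apply/dualP; split.
  by move=> b u v; rewrite zsL mulrDr mulrCA.
exists (`|a| * M + 1); first by rewrite ltr_wpDl// mulr_ge0// ltW.
move=> z; rewrite normrM mulrDl mul1r -mulrA.
by rewrite (le_trans (ler_wpM2l (normr_ge0 a) (zsM z)))// lerDl.
Qed.

Lemma dual_sumprod (R : realType) (X Y : normedModType R) (xs : X -> R)
    (ys : Y -> R) :
  dual xs -> dual ys -> dual (fun w : sumprod X Y => xs w.1 + ys w.2).
Proof.
move=> /dualP[xsL [M M0 xsM]] /dualP[ysL [N N0 ysN]]; apply/dualP; split.
  by move=> a u v /=; rewrite xsL ysL mulrDr addrACA.
exists (M + N) => [|[x y] /=]; first by rewrite addr_gt0.
rewrite sumprod_normE /= (le_trans (ler_normD _ _))//.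
have := xsM x; have := ysN y.
have := mulr_ge0 (ltW M0) (normr_ge0 y).
have := mulr_ge0 (ltW N0) (normr_ge0 x).
lra.
Qed.

Lemma dual_inl (R : realType) (X Y : normedModType R) (u : sumprod X Y -> R) :
  dual u -> dual (fun x => u ((x, 0) : sumprod X Y)).
Proof.
move=> /dualP[uL [M M0 uM]]; apply/dualP; split.
  move=> a x y; rewrite -uL; congr u.
  by apply: injective_projections => //=; rewrite scaler0 addr0.
exists M => // x; rewrite (le_trans (uM _))//.
by rewrite sumprod_normE /= normr0 addr0.
Qed.

Lemma dual_inr (R : realType) (X Y : normedModType R) (u : sumprod X Y -> R) :
  dual u -> dual (fun y => u ((0, y) : sumprod X Y)).
Proof.
move=> /dualP[uL [M M0 uM]]; apply/dualP; split.
  move=> a x y; rewrite -uL; congr u.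
  by apply: injective_projections => //=; rewrite scaler0 addr0.
exists M => // x; rewrite (le_trans (uM _))//.
by rewrite sumprod_normE /= normr0 add0r.
Qed.

Lemma dual_snd (R : realType) (X Y : normedModType R) (ys : Y -> R) :
  dual ys -> dual (fun w : sumprod X Y => ys w.2).
Proof.
move=> /dualP[ysL [N N0 ysN]]; apply/dualP; split.
  by move=> a u v /=; rewrite ysL.
exists N => // -[x y] /=; rewrite sumprod_normE /= (le_trans (ysN y))//.
by rewrite ler_pM2l// lerDr.
Qed.

Lemma dual_mull (R : realType) (t : R) : @dual R R^o (fun r => t * r).
Proof.
apply/dualP; split; first by move=> a x y; rewrite mulrDr mulrCA.
exists (`|t| + 1); first by rewrite ltr_wpDl.
by move=> z; rewrite normrM ler_wpM2r// lerDl.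
Qed.

(** * Normals to epigraphs *)

Definition epi_normal (R : realType) (Z : normedModType R) (f : Z -> \bar R)
    (zb : Z) (t : R) : set (Z -> R) :=
  [set zs | dual zs /\
    regular_normal_cone ((zb, fine (f zb)) : sumprod Z R^o) (epi f)
      (dual_pair zs t)].

Lemma epi_normalP (R : realType) (Z : normedModType R) (f : Z -> \bar R)
    (zb : Z) (t : R) (zs : Z -> R) :
  epi_normal f zb t zs <-> dual zs /\
    forall e : R, 0 < e -> exists2 c : R, 0 < c &
      forall z r, (f z <= r%:E)%E -> `|z - zb| + `|r - fine (f zb)| < c ->
        zs (z - zb) + t * (r - fine (f zb)) <=
        e * (`|z - zb| + `|r - fine (f zb)|).
Proof.
split=> -[zsD zsN]; split=> //.
  move: zsN => /regular_normal_coneP[_ zsN] e /zsN[c c0 cP].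
  by exists c => // z r fz zc; exact: (cP (z, r)).
apply/regular_normal_coneP; split.
  exact: (dual_sumprod zsD (dual_mull t)).
move=> e /zsN[c c0 cP]; exists c => // -[z r] fz zc; exact: cP.
Qed.

(** From left to right, raising [r] above [f z] only decreases the functional. From right to left, a
    failure of the subgradient inequality at [z] puts a point of the epigraph where normality is
    violated. *)
Lemma regular_subdiff_epi_normal (R : realType) (Z : normedModType R)
    (f : Z -> \bar R) (zb : Z) :
  (forall z, f z <> -oo%E) -> f zb \is a fin_num ->
  regular_subdiff f zb = epi_normal f zb (-1).
Proof.
move=> f_proper f_fin; have fzb := fineK f_fin.
set b := fine (f zb) in fzb *.
apply/seteqP; split=> zs.
  move=> [zsD zsN]; apply/epi_normalP; split=> // e e0.
  have [c c0 cP] := zsN e e0; exists c => // z r fz zc.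
  have := cP z; rewrite normed_ballE -fzb => /(_ _).
  have zc' : `|z - zb| < c by rewrite (le_lt_trans _ zc)// lerDl.
  move=> /(_ zc'); case: (f z) (f_proper z) fz => [q _|//|//].
  rewrite lee_fin -!EFinB lee_fin => qr.
  have := mulr_ge0 (ltW e0) (normr_ge0 (r - b)); rewrite /=; lra.
move=> /epi_normalP[zsD zsN]; split=> // e e0.
have /dualP[zsL [M M0 zsM]] := zsD.
have L0 : 0 < 1 + M + e by lra.
(* The test point below lies within [(1 + M + e) * |z - zb|] of the base point. Normality then
   bounds [e * |z - zb|] by half of itself. *)
have [c c0 cP] := zsN (e / (2 * (1 + M + e)))
  ltac:(by rewrite divr_gt0// mulr_gt0).
exists (c / (1 + M + e)); first by rewrite divr_gt0.
move=> z; rewrite normed_ballE ltr_pdivlMr// => zc.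
rewrite -fzb; case fz : (f z) => [q| |]; last by case: (f_proper z fz).
  rewrite -!EFinB lee_fin leNgt; apply/negP => qlt.
  (* A point above the graph, so that normality can be tested at a height
     controlled by [|z - zb|] even if [f z] is far below [f zb]. *)
  set r := b + zs (z - zb) - e * `|z - zb|.
  have rb : `|r - b| <= (M + e) * `|z - zb|.
    have -> : r - b = zs (z - zb) - e * `|z - zb| by rewrite /r; lra.
    rewrite (le_trans (ler_normB _ _))// mulrDl lerD//.
    by rewrite normrM normr_id gtr0_norm.
  have fzr : (f z <= r%:E)%E by rewrite fz lee_fin /r; lra.
  have := cP z r fzr; rewrite -/b => /(_ _) zr.
  have [dpos|] := ltP 0 `|z - zb|; last first.
    rewrite normr_le0 subr_eq0 => /eqP zzb.
    move: fz qlt; rewrite zzb -fzb => -[<-].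
    by rewrite !subrr normr0 mulr0 oppr0 (scalar_fun0 zsL) subr0 ltxx.
  have := zr ltac:(lra).
  have -> : zs (z - zb) + -1 * (r - b) = e * `|z - zb| by rewrite /r; lra.
  rewrite mulrAC ler_pdivlMr ?mulr_gt0//.
  have := mulr_gt0 e0 dpos => ed; have := ler_wpM2l (ltW e0) rb; nra.
by rewrite addye// leey.
Qed.

(** * The two inclusions of the chain rule *)

(** Add the inequality for [xs] at [x] to the one for [(ys, t)] at [(g x, r)]: the terms in [ys]
    cancel, and calmness bounds the error by the distance from [(x, r)] to its base point. *)
Lemma epi_normal_comp_sup (R : realType) (X Y : normedModType R) (g : X -> Y)
    (xb : X) (h : Y -> \bar R) (t : R) (ys : Y -> R) :
  calm_at g xb -> epi_normal h (g xb) t ys ->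
  regular_subdiff (fun x => (ys (g x))%:E) xb `<=` epi_normal (h \o g) xb t.
Proof.
move=> [r0 [l [r00 l0 gl]]] /epi_normalP[/dualP[ysL _] ysN] xs [xsD xsN].
apply/epi_normalP; split=> //= e e0.
have L0 : 0 < 1 + l by lra.
have [c c0 cP] := ysN (e / 2 / (1 + l)) ltac:(by rewrite !divr_gt0).
have [d d0 dP] := xsN (e / 2) ltac:(by rewrite divr_gt0).
(* By calmness, the last radius brings [(g x, r)] within [c] of its base point. *)
exists (Num.min (Num.min r0 d) (c / (1 + l))).
  by rewrite !lt_min r00 d0 divr_gt0.
move=> x r hr; rewrite !lt_min ltr_pdivlMr// => /andP[/andP[xr0 xd] xc].
have rx0 := normr_ge0 (r - fine (h (g xb))).
have xx0 := normr_ge0 (x - xb).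
have := gl x; rewrite normed_ballE => /(_ ltac:(lra)) gx.
have := dP x; rewrite normed_ballE => /(_ ltac:(lra)).
rewrite -!EFinB lee_fin -(scalar_funB ysL) => xsx.
have lr : 0 <= l * `|r - fine (h (g xb))| by rewrite mulr_ge0.
have := cP (g x) r hr ltac:(nra) => ysr.
have := ler_wpM2l (ltac:(by rewrite !divr_ge0// ltW) : 0 <= e / 2 / (1 + l))
  (ltac:(lra) : `|g x - g xb| + `|r - fine (h (g xb))|
     <= (1 + l) * (`|x - xb| + `|r - fine (h (g xb))|)).
rewrite mulrA divfK ?gt_eqF// => H.
have := mulr_ge0 (ltW e0) rx0.
lra.
Qed.

Lemma epi_normal_comp_sub (R : realType) (X Y : normedModType R) (g : X -> Y)
    (xb : X) (h : Y -> \bar R) (t : R) :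
  calm_at g xb -> h (g xb) \is a fin_num ->
  metric_qualification2 (@X_times_epi R X Y h) (@gph_times_R R X Y g)
    ((xb, (g xb, fine (h (g xb)))) : sumprod X (sumprod Y R^o)) ->
  epi_normal (h \o g) xb t `<=`
  \bigcup_(ys in epi_normal h (g xb) t)
    regular_subdiff (fun x => (ys (g x))%:E) xb.
Proof.
move=> [r0 [l [r00 l0 gl]]] h_fin [a a0 Q2] xs /epi_normalP[xsD xsN].
have /dualP[xsL [M M0 xsM]] := xsD.
set b := fine (h (g xb)) in Q2 xsN *.
set W := sumprod X (sumprod Y R^o).
pose pt x y (r : R) : W := (x, (y, r)).
pose wb := pt xb (g xb) b.
have ptE x y r x' y' r' :
    pt (x + x') (y + y') (r + r') = pt x y r + pt x' y' r' by [].
have ptZ s x y r : s *: pt x y r = pt (s *: x) (s *: y) (s * r) by [].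
(* [K] dominates the dual norm of [(xs, 0, t)], so [ws] lies in the dual unit ball. *)
pose K := M + `|t| + 1.
have K0 : 0 < K by rewrite ltr_wpDl// addr_ge0// ltW.
pose ws : W -> R := fun w => K^-1 * (xs w.1 + t * w.2.2).
have hgb : h (g xb) = b%:E by rewrite /b fineK.
have Cb : X_times_epi h wb by rewrite /X_times_epi /epi /= hgb.
have Db : gph_times_R g wb by [].
have wsD : dual ws.
  exact: (dualZ _ (dual_sumprod xsD (dual_snd _ (dual_mull t)))).
have ws1 w : ws w <= `|w|.
  case: w => x [y r]; rewrite /ws /= !sumprod_normE /= ler_pdivrMl//.
  have := le_trans (ler_norm _) (xsM x).
  have := ler_norm (t * r); rewrite normrM.
  have := mulr_ge0 (normr_ge0 t) (normr_ge0 x).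
  have := mulr_ge0 (ltW M0) (normr_ge0 r).
  have := mulr_ge0 (ltW K0) (normr_ge0 y).
  have := normr_ge0 x; have := normr_ge0 r.
  rewrite /K; lra.
(* On the intersection [y = g x], so [(x, r)] lies in the epigraph of [h \o g]; the extra term
   [|y - g xb|] only enlarges the right-hand side. *)
have wsN : normal_ineq ws wb (X_times_epi h `&` gph_times_R g).
  move=> e e0; have [c c0 cP] := xsN (e * K) ltac:(by rewrite mulr_gt0).
  exists c => // -[x [y r]] [/= hr]; rewrite /gph_times_R /gph /= => yg.
  rewrite /X_times_epi /epi /= yg in hr.
  rewrite !sumprod_normE /= => wc.
  rewrite /ws /= ler_pdivrMl// mulrA [K * e]mulrC.
  have := normr_ge0 (y - g xb) => y0.
  have := cP x r hr ltac:(lra) => /le_trans; apply.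
  by rewrite ler_pM2l ?mulr_gt0// lerD2l lerDr.
have [u us [v vs wE]] := Q2 _ (regular_subdiff_edist_inf (conj Cb Db) wsD ws1 wsN).
have uD := us.1; have vD := vs.1.
have uL := uD.1; have vL := vD.1.
have uN := regular_subdiff_edist_inf_normal Cb us.
have vN := regular_subdiff_edist_inf_normal Db vs.
have {}wE x y r : K^-1 * (xs x + t * r) = a * u (pt x y r) + a * v (pt x y r).
  by have := congr1 (fun f => f (pt x y r)) wE => /= ->.
have u10 x : u (pt x 0 0) = 0.
  have u1 z : u (pt z 0 0) <= 0.
    apply: (normal_ineq_dir_le0 uL uN) => s s0.
    by rewrite ptZ -ptE scaler0 mulr0 !addr0 /X_times_epi /epi /= hgb.
  apply/eqP; rewrite eq_le u1 /=.
  have := u1 (- x).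
  have -> : pt (- x) 0 0 = (-1) *: pt x 0 0.
    by rewrite ptZ scaleN1r scaler0 mulr0.
  by rewrite (scalar_funZ uL) mulN1r oppr_le0.
have v30 r : v (pt 0 0 r) = 0.
  have v3 q : v (pt 0 0 q) <= 0.
    apply: (normal_ineq_dir_le0 vL vN) => s s0.
    by rewrite ptZ -ptE !scaler0 !addr0.
  apply/eqP; rewrite eq_le v3 /=.
  have := v3 (- r).
  have -> : pt 0 0 (- r) = (-1) *: pt 0 0 r.
    by rewrite ptZ !scaler0 mulN1r.
  by rewrite (scalar_funZ vL) mulN1r oppr_le0.
have xsE x : xs x = K * a * v (pt x 0 0).
  have := wE x 0 0; rewrite u10 mulr0 addr0 mulr0 add0r => /(congr1 ( *%R K)).
  by rewrite mulVKf ?gt_eqF// mulrA.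
have tE r : t * r = K * a * u (pt 0 0 r).
  have := wE 0 0 r; rewrite v30 (scalar_fun0 xsL) add0r mulr0 addr0.
  move=> /(congr1 ( *%R K)).
  by rewrite mulVKf ?gt_eqF// mulrA.
(* Since [ws] vanishes on [(0, y, 0)], the [Y]-components of [u] and [v] are opposite. *)
pose ys y := K * a * u (pt 0 y 0).
have ysE y : ys y = - (K * a * v (pt 0 y 0)).
  have := wE 0 y 0; rewrite (scalar_fun0 xsL) !mulr0 addr0 mulr0.
  move=> /esym/eqP; rewrite -mulrDr mulf_eq0 gt_eqF//= addr_eq0 => /eqP uv.
  by rewrite /ys uv mulrN.
have ysD : dual ys by exact: (dualZ _ (dual_inl (dual_inr uD))).
have Ka0 : 0 < K * a by rewrite mulr_gt0.
exists ys.
  apply/epi_normalP; split=> // e e0.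
  (* Normality of [u] is tested at the points [(xb, y, r)] of [C]. *)
  have [c c0 cP] := uN (e / (K * a)) ltac:(by rewrite divr_gt0).
  exists c => // y r hr yc.
  have := cP (pt xb y r) hr.
  have -> : pt xb y r - wb = pt 0 (y - g xb) 0 + pt 0 0 (r - b).
    by rewrite -ptE !addr0 add0r -[in RHS](subrr xb).
  rewrite (scalar_funD uL) -ptE !sumprod_normE /= !addr0 !add0r.
  rewrite normr0 add0r => /(_ yc).
  by rewrite /ys tE -mulrDr mulrAC ler_pdivlMr// mulrC.
split=> // e e0.
have L0 : 0 < 1 + l by lra.
(* Normality of [v] is tested at the points [(x, g x, b)] of [D], whose distance to [wb] is at most
   [(1 + l) * |x - xb|] by calmness. *)
have [c c0 cP] := vN (e / (K * a) / (1 + l)) ltac:(by rewrite !divr_gt0).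
exists (Num.min r0 (c / (1 + l))); first by rewrite lt_min r00 divr_gt0.
move=> x; rewrite normed_ballE lt_min ltr_pdivlMr// => /andP[xr0 xc].
have := gl x; rewrite normed_ballE => /(_ xr0) gx.
rewrite -!EFinB lee_fin -(scalar_funB ysD.1).
have := cP (pt x (g x) b) erefl.
have -> : pt x (g x) b - wb = pt (x - xb) 0 0 + pt 0 (g x - g xb) 0.
  by rewrite -ptE !addr0 add0r -[in RHS](subrr b).
rewrite (scalar_funD vL) -ptE !sumprod_normE /= !addr0 !add0r.
rewrite normr0 addr0 => /(_ ltac:(lra)).
move=> /(ler_wpM2l (ltW Ka0)); rewrite mulrDr -xsE -[_ * v _]opprK -ysE => H.
suff : K * a * (e / (K * a) / (1 + l) * (`|x - xb| + `|g x - g xb|)) <=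
    e * `|x - xb| by lra.
have -> : K * a * (e / (K * a) / (1 + l) * (`|x - xb| + `|g x - g xb|)) =
    e * ((`|x - xb| + `|g x - g xb|) / (1 + l)).
  by field; rewrite !gt_eqF.
by rewrite ler_pM2l// ler_pdivrMr//; lra.
Qed.

Theorem theorem5p4 (R : realType) (X Y : normedModType R)
    (g : X -> Y) (xb : X) (h : Y -> \bar R)
    (g_calm : calm_at g xb)
    (h_proper : forall y : Y, h y <> -oo%E)
    (h_fin : h (g xb) \is a fin_num)
    (Q2 : metric_qualification2
            (@X_times_epi R X Y h) (@gph_times_R R X Y g)
            ((xb, (g xb, fine (h (g xb)))) : sumprod X (sumprod Y R^o))) :
  regular_subdiff (h \o g) xb =
    \bigcup_(ys in regular_subdiff h (g xb))
      regular_subdiff (fun x : X => (ys (g x))%:E) xb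
  /\
  singular_regular_subdiff (h \o g) xb =
    \bigcup_(ys in singular_regular_subdiff h (g xb))
      regular_subdiff (fun x : X => (ys (g x))%:E) xb.
Proof.
have epi_normal_comp t : epi_normal (h \o g) xb t =
    \bigcup_(ys in epi_normal h (g xb) t)
      regular_subdiff (fun x : X => (ys (g x))%:E) xb.
  apply/seteqP; split; first exact: epi_normal_comp_sub.
  by apply: bigcup_sub => ys; exact: epi_normal_comp_sup.
(* The singular subdifferential is [epi_normal] at [t = 0] by mere unfolding. *)
by split; [rewrite !regular_subdiff_epi_normal//= | ]; exact: epi_normal_comp.
Qed.
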